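(* For any $N\times N$ unitary matrix $U$ and any $N\times N$ permutation matrices $P_r,P_c$, $$\mathbf d(P_r\cdot U\cdot P_c)=\mathbf d(U).$$
   Context: Let $f$ be the map sending a complex $N\times N$ matrix $U$ to the real matrix $(|U_{i,j}|^2)_{i,j}$, regarded as a smooth map between real vector spaces, with differential at $U$ given by $Df_U(V)=\big(2\,\mathrm{Re}(\overline{U_{i,j}}V_{i,j})\big)_{i,j}$. For an $N\times N$ unitary matrix $U$ let $T_U=\{EU: E\in\mathbb C^{N\times N},\ E^*=-E\}$ be the (real) tangent space at $U$ to the manifold of unitary matrices. The defect of $U$ is the integer $\mathbf d(U)=(N-1)^2-\dim_{\mathbb R}Df_U(T_U)$. *)

(* Defs.v *)
From mathcomp Require Import all_boot all_order all_algebra.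
From mathcomp Require Import boolp classical_sets reals complex.

Set Implicit Arguments.
Unset Strict Implicit.
Unset Printing Implicit Defensive.

Import Order.TTheory GRing.Theory Num.Theory.

Local Open Scope ring_scope.
Local Open Scope classical_set_scope.
Local Open Scope sesquilinear_scope.

(* The dimension of a set of vectors that is a linear subspace, and 0 for any
   other set: [xget] returns the unique [W] with carrier [A], if there is one. *)
Definition set_dim (K : fieldType) (V : vectType K) (A : set V) : nat :=
  \dim (xget 0%VS [set W : {vspace V} | A = [set v | v \in W]]).

Definition sqmod_mx (R : realType) (N : nat) (U : 'M[R[i]]_N) : 'M[R]_N :=
  \matrix_(i, j) complex.Re (`|U i j| ^+ 2).

(* The differential of [sqmod_mx] at [U]; see [sqmod_mxD]. *)
Definition Dsqmod_mx (R : realType) (N : nat) (U V : 'M[R[i]]_N) : 'M[R]_N :=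
  \matrix_(i, j) (2 * complex.Re ((U i j)^* * V i j)).

Definition unitary_tangent (R : realType) (N : nat) (U : 'M[R[i]]_N) :
    set 'M[R[i]]_N :=
  [set E *m U | E in [set E : 'M[R[i]]_N | E^t* = - E]].

Definition defect (R : realType) (N : nat) (U : 'M[R[i]]_N) : int :=
  (N%:Z - 1) ^+ 2 - (set_dim (Dsqmod_mx U @` unitary_tangent U))%:Z.

Lemma set_dimE (K : fieldType) (V : vectType K) (W : {vspace V}) :
  set_dim [set v | v \in W] = \dim W.
Proof.
rewrite /set_dim; case: xgetP => [W' _ /= eqW | /(_ W) /= []//].
congr (\dim _); apply/vspaceP => v.
by have := congr1 (fun A : set V => A v) eqW => /= vW; apply/idP/idP; rewrite vW.
Qed.

Lemma submod_set_vspace (K : fieldType) (V : vectType K) (A : set V) :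
  A 0 -> (forall (a : K) u v, A u -> A v -> A (a *: u + v)) ->
  exists W : {vspace V}, A = [set v | v \in W].
Proof.
move=> A0 AP.
pose P n := `[< exists2 W : {vspace V}, [set v | v \in W] `<=` A & \dim W = n >].
have exP : exists n, P n.
  exists 0%N; apply/asboolP; exists 0%VS; last exact: dimv0.
  by move=> v /=; rewrite memv0 => /eqP->.
have ubP n : P n -> (n <= \dim {:V})%N.
  by move=> /asboolP[W _ <-]; apply: dimvS; exact: subvf.
case: (ex_maxnP exP ubP) => n /asboolP[W WA dimW] maxn; exists W.
apply/seteqP; split => // v Av /=; apply: contraT => vW.
have /maxn : P (\dim (<[v]> + W)%VS).
  apply/asboolP; exists (<[v]> + W)%VS => //.
  move=> _ /= /memv_addP[_ /vlineP[a ->]] [w wW ->].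
  by apply: AP => //; apply: WA.
rewrite -dimW => le_dim; have /eqP WE : W == (<[v]> + W)%VS.
  by rewrite eqEdim addvSr.
by move: vW; rewrite WE => /negP[]; rewrite memvE addvSl.
Qed.

Lemma ReD (R : realType) (x y : R[i]) :
  complex.Re (x + y) = complex.Re x + complex.Re y.
Proof. by case: x; case: y. Qed.

Lemma ReZ (R : realType) (a : R) (x : R[i]) :
  complex.Re (a%:C%C * x) = a * complex.Re x.
Proof. by case: x => b c /=; rewrite mul0r subr0. Qed.

Lemma Re_conjM (R : realType) (x y : R[i]) :
  complex.Re (x^* * y) = complex.Re (y^* * x).
Proof.
by case: x y => [a b] [c d] /=; rewrite !mulNr !opprK mulrC (mulrC b).
Qed.

Lemma sqmod_mxD (R : realType) (N : nat) (U V : 'M[R[i]]_N) :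
  sqmod_mx (U + V) = sqmod_mx U + Dsqmod_mx U V + sqmod_mx V.
Proof.
apply/matrixP => i j; rewrite !mxE !normCKC rmorphD /= mulrDl !mulrDr !ReD.
by rewrite (Re_conjM (V i j) (U i j)) mulr_natl mulr2n !addrA.
Qed.

Lemma Dsqmod_mx_linear (R : realType) (N : nat) (U : 'M[R[i]]_N) (a : R)
    (V W : 'M[R[i]]_N) :
  Dsqmod_mx U (a%:C%C *: V + W) = a *: Dsqmod_mx U V + Dsqmod_mx U W.
Proof.
apply/matrixP => i j; rewrite !mxE mulrDr ReD mulrCA ReZ mulrDr.
by congr (_ + _); rewrite mulrCA.
Qed.

(* In particular the image in [defect] is a subspace, so that its [set_dim] is
   its dimension. *)
Lemma Dsqmod_mx_tangent_vspace (R : realType) (N : nat) (U : 'M[R[i]]_N) :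
  exists W : {vspace 'M[R]_N},
    Dsqmod_mx U @` unitary_tangent U = [set M | M \in W].
Proof.
apply: submod_set_vspace.
  exists 0; first by exists 0; rewrite ?mul0mx //= trmx0 map_mx0 oppr0.
  by apply/matrixP => i j; rewrite !mxE mulr0 mulr0.
move=> a _ _ [_ [E /= hE <-] <-] [_ [F /= hF <-] <-].
exists ((a%:C%C *: E + F) *m U); last first.
  by rewrite mulmxDl -scalemxAl Dsqmod_mx_linear.
exists (a%:C%C *: E + F) => //=.
have aR : (a%:C%C : R[i])^* = a%:C%C by exact: conjc_real.
by rewrite linearD linearZ /= map_mxD map_mxZ hE hF /= aR scalerN opprD.
Qed.

(* Main.v *)
Require Import Defs.
From mathcomp Require Import all_boot all_order all_algebra.
From mathcomp Require Import boolp classical_sets reals complex.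
From mathcomp Require Import perm.
Local Open Scope ring_scope.

(* Entrywise, passing from U to Pr U Pc is a relabelling of rows and columns,
   which commutes with the differential of f. As EPU = P (P^* E P) U for a
   permutation matrix P, and conjugation by P preserves antihermitian matrices,
   the relabelling also maps T_U onto the tangent space at Pr U Pc. So the image
   of the differential is transported by an injective linear map, and its
   dimension is unchanged. *)

Local Open Scope classical_set_scope.
Local Open Scope sesquilinear_scope.

Lemma perm_mx_mul_mxsub {R : pzSemiRingType} {m n : nat} (s : 'S_m) (t : 'S_n)
    (A : 'M[R]_(m, n)) :
  perm_mx s *m A *m perm_mx t = mxsub s (t^-1)%g A.
Proof.
by rewrite -row_permE -[t in LHS]invgK -col_permE; apply/matrixP => i j; rewrite !mxE.
Qed.

(** Relabelling the summed index by a bijection only reorders each sum. *)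
Lemma mulmx_mxsub_perm {R : pzSemiRingType} {m m' n p p' : nat} (s : 'S_n)
    (f : 'I_m' -> 'I_m) (g : 'I_p' -> 'I_p)
    (A : 'M[R]_(m, n)) (B : 'M[R]_(n, p)) :
  mxsub f s A *m mxsub s g B = mxsub f g (A *m B).
Proof.
apply/matrixP => i j; rewrite !mxE [RHS](reindex_inj (@perm_inj _ s)).
by apply: eq_bigr => k _; rewrite !mxE.
Qed.

Lemma mxsub_permK {R : Type} {m n : nat} (s : 'S_m) (t : 'S_n) :
  cancel (mxsub s t : 'M[R]_(m, n) -> 'M_(m, n)) (mxsub (s^-1)%g (t^-1)%g).
Proof. by move=> A; apply/matrixP => i j; rewrite !mxE !permKV. Qed.

Lemma set_dim_image_inj {K : fieldType} {V W : vectType K}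
    (f : {linear V -> W}) (A : set V) :
  injective f -> (exists U : {vspace V}, A = [set v | v \in U]) ->
  set_dim (f @` A) = set_dim A.
Proof.
move=> f_inj [U ->].
have -> : f @` [set v | v \in U] = [set w | w \in (linfun f @: U)%VS].
  apply/seteqP; split => [_ [v /= vU <-]|_ /= /memv_imgP[v vU ->]].
    by rewrite -(lfunE f) memv_img.
  by exists v => //; rewrite lfunE.
(* The dimension is preserved because [U] meets the kernel trivially. *)
rewrite !set_dimE limg_dim_eq //; have /eqP-> : lker (linfun f) == 0%VS.
  by apply/lker0P => u v; rewrite !lfunE => /f_inj.
exact: capv0.
Qed.

Lemma Dsqmod_mx_mxsub {R : realType} {N : nat} (f g : 'I_N -> 'I_N)
    (U V : 'M[R[i]]_N) :
  Dsqmod_mx (mxsub f g U) (mxsub f g V) = mxsub f g (Dsqmod_mx U V).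
Proof. by apply/matrixP => i j; rewrite !mxE. Qed.

(** Relabelling rows and columns by the same [f] commutes with the conjugate transpose. *)
Lemma antihermitian_mxsub {R : realType} {N : nat} (f : 'I_N -> 'I_N)
    (E : 'M[R[i]]_N) :
  E^t* = - E -> (mxsub f f E)^t* = - mxsub f f E.
Proof.
move=> hE; apply/matrixP => i j; rewrite !mxE.
by have /matrixP/(_ (f i) (f j)) := hE; rewrite !mxE.
Qed.

Lemma unitary_tangent_mxsub {R : realType} {N : nat} (s t : 'S_N)
    (U : 'M[R[i]]_N) :
  unitary_tangent (mxsub s t U) = mxsub s t @` unitary_tangent U.
Proof.
apply/seteqP; split => [_ [E /= hE <-]|_ [_ [E /= hE <-] <-]].
  (* Conjugating [E] back by [s] compensates for the row relabelling of [U]; the column relabelling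
     [t] does not touch [E]. *)
  exists (mxsub (s^-1)%g (s^-1)%g E *m U).
    by exists (mxsub (s^-1)%g (s^-1)%g E) => //; exact: antihermitian_mxsub.
  rewrite -(mulmx_mxsub_perm s); congr (_ *m _).
  by apply/matrixP => i j; rewrite !mxE !permK.
exists (mxsub s s E); first exact: antihermitian_mxsub.
exact: mulmx_mxsub_perm.
Qed.

Lemma defect_mxsub {R : realType} {N : nat} (s t : 'S_N) (U : 'M[R[i]]_N) :
  defect (mxsub s t U) = defect U.
Proof.
rewrite /defect unitary_tangent_mxsub image_comp.
(* The relabelling moves from complex tangent vectors to real matrices, where it is a linear map
   over the field in which the dimension is taken. *)
have -> : (Dsqmod_mx (mxsub s t U) \o mxsub s t) = mxsub s t \o Dsqmod_mx U.
  by apply/funext => V; exact: Dsqmod_mx_mxsub.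
rewrite -image_comp set_dim_image_inj //; first exact: can_inj (mxsub_permK s t).
exact: Dsqmod_mx_tangent_vspace.
Qed.

Theorem lemma3p1 (R : realType) (N : nat) (U Pr Pc : 'M[R[i]]_N)
    (hU : U \is unitarymx) (hPr : is_perm_mx Pr) (hPc : is_perm_mx Pc) :
  defect (Pr *m U *m Pc) = defect U.
Proof.
have /is_perm_mxP[s ->] := hPr; have /is_perm_mxP[t ->] := hPc.
by rewrite perm_mx_mul_mxsub defect_mxsub.
Qed.
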